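(* The set $\mathrm{MP}$ of all max-preserving maps from $\mathbb{R}^n_+$ into itself is a $(\circ,\oplus)$-semiring with identity element $\mathrm{id}_{\mathbb{R}^n_+}$ and neutral element $0_{\mathbb{R}^n_+}$.
   Context: $\mathbb{R}^n_+=[0,\infty)^n$, and for $x,y\in\mathbb{R}^n$, $x\oplus y=\max\{x,y\}$ is the component-wise maximum. The set of max-preserving maps is $$\mathrm{MP}=\mathrm{MP}(\mathbb{R}^n_+)=\{A\colon\mathbb{R}^n_+\to\mathbb{R}^n_+ \text{ such that } A(x\oplus y)=(Ax)\oplus(Ay)\text{ for all }x,y\in\mathbb{R}^n_+\}.$$ On maps, $\circ$ is composition and $\oplus$ is the pointwise maximum operation $(A\oplus B)(x)=(Ax)\oplus(Bx)$. $\mathrm{id}_{\mathbb{R}^n_+}$ is the identity map of $\mathbb{R}^n_+$ (the identity element for composition), and $0_{\mathbb{R}^n_+}$ is the map sending every element of $\mathbb{R}^n_+$ to $0\in\mathbb{R}^n_+$ (the neutral element for the maximum operation). *)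

(* Defs.v *)
From mathcomp Require Import all_boot all_order all_algebra.
From mathcomp Require Import boolp classical_sets reals interval_inference.
Set Implicit Arguments.
Unset Strict Implicit.
Unset Printing Implicit Defensive.
Import Order.TTheory GRing.Theory Num.Theory.
Local Open Scope classical_set_scope.
Local Open Scope ring_scope.

Section Semiring.
Variable T : Type.
Implicit Types (S : set T) (mul add op : T -> T -> T) (e one zero : T).

Definition monoid_on S op e : Prop :=
  [/\ S e,
      forall x y, S x -> S y -> S (op x y),
      forall x y z, S x -> S y -> S z -> op x (op y z) = op (op x y) z,
      forall x, S x -> op e x = x
    & forall x, S x -> op x e = x].

(* The neutral element of [add] is not required to be absorbing for [mul].
   This is why [GRing.PzSemiRing] is not used: a nonzero constant map [A] on
   the orthant preserves maxima and does not satisfy [A \o 0 = 0]. *)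
Definition semiring_on S mul add one zero : Prop :=
  [/\ monoid_on S add zero,
      forall x y, S x -> S y -> add x y = add y x,
      monoid_on S mul one,
      forall x y z, S x -> S y -> S z ->
        mul x (add y z) = add (mul x y) (mul x z)
    & forall x y z, S x -> S y -> S z ->
        mul (add x y) z = add (mul x z) (mul y z)].

End Semiring.

Section MaxPreserving.
Variables (R : realType) (n : nat).

Definition orthant : Type := 'rV[{nonneg R}]_n.

Definition vmax (x y : orthant) : orthant :=
  \row_i Num.max (x ord0 i) (y ord0 i).

Definition max_preserving : set (orthant -> orthant) :=
  [set A | forall x y, A (vmax x y) = vmax (A x) (A y)].

Definition orthant_comp (A B : orthant -> orthant) : orthant -> orthant := A \o B.

Definition orthant_max (A B : orthant -> orthant) : orthant -> orthant :=
  fun x => vmax (A x) (B x).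

Definition orthant_id : orthant -> orthant := id.

Definition orthant_zero : orthant -> orthant := fun=> const_mx 0%:nng.

End MaxPreserving.

(* Main.v *)
Require Import Defs.
From mathcomp Require Import all_boot all_order all_algebra.
From mathcomp Require Import boolp classical_sets reals interval_inference.

(** The orthant is a join-semilattice under [vmax] with least element the
    origin, because its coordinates range over a chain with least element 0;
    so pointwise maxima make all self-maps of the orthant a commutative monoid.
    Max-preserving maps are the endomorphisms of this semilattice, and they are
    closed under pointwise maximum for the same reason that homomorphisms into
    a commutative monoid are closed under pointwise addition: the interchange
    law [vmaxACA].  Right distributivity of composition over the maximum holds
    for arbitrary maps, while left distributivity
    [A \o (B (+) C) = (A \o B) (+) (A \o C)] is the max-preservation of [A],
    evaluated at the points [B x] and [C x]. *)

Import Order.TTheory.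

Section VectorMax.
Variables (R : realType) (n : nat).
Implicit Types x y z t : orthant R n.

Lemma vmaxA x y z : vmax x (vmax y z) = vmax (vmax x y) z.
Proof. by apply/rowP => i; rewrite !mxE maxA. Qed.

Lemma vmaxC x y : vmax x y = vmax y x.
Proof. by apply/rowP => i; rewrite !mxE maxC. Qed.

Lemma vmaxxx x : vmax x x = x.
Proof. by apply/rowP => i; rewrite !mxE maxxx. Qed.

Lemma vmaxACA x y z t :
  vmax (vmax x y) (vmax z t) = vmax (vmax x z) (vmax y t).
Proof. by rewrite -!vmaxA (vmaxA y) (vmaxC y) -vmaxA. Qed.

Lemma vmax0x x y : vmax (orthant_zero x) y = y.
Proof.
apply/rowP => i; rewrite !mxE; apply/max_idPr.
(* The order on nonnegative reals is that of the underlying reals. *)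
by rewrite -num_le /=.
Qed.

End VectorMax.

Section Closure.
Variables (R : realType) (n : nat).
Implicit Types A B : orthant R n -> orthant R n.

Lemma max_preserving_zero : max_preserving (@orthant_zero R n).
Proof. by move=> x y; rewrite [RHS]vmaxxx. Qed.

Lemma max_preserving_max A B :
  max_preserving A -> max_preserving B -> max_preserving (orthant_max A B).
Proof. by move=> hA hB x y; rewrite /orthant_max hA hB vmaxACA. Qed.

Lemma max_preserving_comp A B :
  max_preserving A -> max_preserving B -> max_preserving (orthant_comp A B).
Proof. by move=> hA hB x y; rewrite /orthant_comp /= hB hA. Qed.

End Closure.

Theorem lemma1 (R : realType) (n : nat) :
  semiring_on (@max_preserving R n) (@orthant_comp R n) (@orthant_max R n)
    (@orthant_id R n) (@orthant_zero R n).
Proof.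
split.
- split.
  + exact: max_preserving_zero.
  + exact: max_preserving_max.
  + by move=> A B C _ _ _; apply/funext => x; exact: vmaxA.
  + by move=> A _; apply/funext => x; exact: vmax0x.
  + by move=> A _; apply/funext => x; rewrite /orthant_max vmaxC; exact: vmax0x.
- by move=> A B _ _; apply/funext => x; exact: vmaxC.
- split=> //.
  exact: max_preserving_comp.
- by move=> A B C hA _ _; apply/funext => x; exact: hA.
- by [].
Qed.
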